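(* Let $m\ge 1$. The set $\{M_{\mathbf w} \mid \mathbf w \in \mathrm{MComp}\}$ of monomial multi-quasisymmetric functions is a $\mathbf k$-basis of the $\mathbf k$-module $\mathrm{MQSym}$ of multi-quasisymmetric functions.
   Context: $\mathbf k$ is a commutative unitary ring containing $\mathbb Q$; $m$ is a fixed positive integer, $[m]=\{1,\dots,m\}$, $\mathbb N=\{0,1,2,\dots\}$, $\mathbb P=\{1,2,\dots\}$. Let $X=\{x_{i,j}\mid i\in[m], j\in\mathbb P\}$ be mutually commuting variables and $\mathbf k[[X]]$ the algebra of formal power series in $X$. A multi-composition (or $[m]$-composition) of length $k$ is a matrix $\mathbf w=(w_1,\dots,w_k)\in\mathbb N^{m\times k}$ all of whose columns $w_1,\dots,w_k$ are nonzero; the empty multi-composition of length $0$ is included. $\mathrm{MComp}$ is the set of all multi-compositions. For $w=(a_1,\dots,a_m)\in\mathbb N^m$ and $j\in\mathbb P$ put $x_j^w:=x_{1,j}^{a_1}\cdots x_{m,j}^{a_m}$. A formal power series $f\in\mathbf k[[X]]$ of bounded degree is a multi-quasisymmetric function if for each multi-composition $\mathbf w=(w_1,\dots,w_k)$ the coefficients in $f$ of the monomials $x_{j_1}^{w_1}\cdots x_{j_k}^{w_k}$ are equal for all integers $1\le j_1<\cdots<j_k$. $\mathrm{MQSym}$ is the set of all of them. For $\mathbf w=(w_1,\dots,w_k)\in\mathrm{MComp}$, $M_{\mathbf w}:=\sum_{1\le j_1<\cdots<j_k} x_{j_1}^{w_1}\cdots x_{j_k}^{w_k}$, with $M_{\mathbf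 w}=1$ for the empty multi-composition. *)

(* Defs.v *)
From HB Require Import structures.
From mathcomp Require Import all_boot all_order all_algebra finmap.
From mathcomp Require Import boolp classical_sets functions cardinality fsbigop.
From mathcomp Require Import monalg.
Set Implicit Arguments.
Unset Strict Implicit.
Unset Printing Implicit Defensive.
Import GRing.Theory.
Local Open Scope classical_set_scope.
Local Open Scope ring_scope.

Section Basis.
Variables (R : nzRingType) (V : lmodType R).

Definition linearly_independent (B : set V) : Prop :=
  forall (s : seq V) (c : V -> R), uniq s -> [set` s] `<=` B ->
    \sum_(v <- s) c v *: v = 0 -> forall v, v \in s -> c v = 0.

Definition linear_span (B : set V) : set V :=
  [set f | exists (s : seq V) (c : V -> R),
     [set` s] `<=` B /\ f = \sum_(v <- s) c v *: v].

(* The last equation includes the inclusion of B in N and forces N to be a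
   submodule of V. *)
Definition is_basis_of (N B : set V) : Prop :=
  linearly_independent B /\ linear_span B = N.

End Basis.

(* The variables x_{i,j}, i in [m], j in {1, 2, ...}, with both indices shifted
   down by one: the pair (i, j) stands for x_{i+1,j+1}. *)
Definition var (m : nat) : choiceType := ('I_m * nat)%type.

Definition monomial (m : nat) : conomType := {cmonom (var m)}.

(* k[[X]] as a k-module: a series is the family of its coefficients, with no
   restriction since there are infinitely many variables but each monomial
   involves finitely many of them. R^o makes the scalar action that of R on
   itself, coefficientwise. *)
Definition fps (m : nat) (R : nzRingType) := monomial m -> R^o.
HB.instance Definition _ (m : nat) (R : nzRingType) :=
  GRing.Lmodule.copy (fps m R) (monomial m -> R^o).

Record mcomp (m : nat) := MComp {
  mcomp_length : nat;
  mcomp_mx :> 'M[nat]_(m, mcomp_length);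
  mcomp_col_neq0 : forall l, col l mcomp_mx != 0
}.

Section MQSym.
Variable m : nat.

(* x_j^w = x_{1,j}^{a_1} ... x_{m,j}^{a_m} for w = (a_1, ..., a_m). *)
Definition xpow (j : nat) (w : 'cV[nat]_m) : monomial m :=
  \big[mmul/mone]_(i < m) expcmn (ucm ((i, j) : var m)) (w i 0).

(* x_{j_1}^{w_1} ... x_{j_k}^{w_k}. *)
Definition xmon (w : mcomp m) (j : (mcomp_length w).-tuple nat) : monomial m :=
  \big[mmul/mone]_(l < mcomp_length w) xpow (tnth j l) (col l w).
Arguments xmon : clear implicits.

Variable R : nzRingType.

Definition bounded_degree (f : fps m R) : Prop :=
  exists d : nat, forall u : monomial m, f u != 0 -> (mdeg u <= d)%N.

Definition MQSym : set (fps m R) :=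
  [set f | bounded_degree f /\
    forall (w : mcomp m) (j j' : (mcomp_length w).-tuple nat),
      sorted ltn j -> sorted ltn j' -> f (xmon w j) = f (xmon w j')].

(* The infinite sum of monomials is taken coefficientwise: the coefficient of u
   is the sum over j_1 < ... < j_k of the coefficient of u in xmon w j. Only
   finitely many j contribute, because all columns of w are nonzero. *)
Definition monomial_mqsym (w : mcomp m) : fps m R :=
  fun u => \sum_(j \in [set j : (mcomp_length w).-tuple nat | sorted ltn j])
    ((xmon w j == u)%:R : R).

Lemma MQSym_submod (a : R) (f g : fps m R) :
  MQSym f -> MQSym g -> MQSym (a *: f + g).
Proof.
move=> [[d bf] sf] [[e bg] sg]; split; last first.
  move=> w j j' jP jP'.
  by change (a * f (xmon w j) + g (xmon w j) = a * f (xmon w j') + g (xmon w j'));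
     rewrite (sf w j j') // (sg w j j').
exists (maxn d e) => u; change (a * f u + g u != 0 -> (mdeg u <= maxn d e)%N).
rewrite leq_max; have [-> | /bf -> //] := eqVneq (f u) 0.
by rewrite mulr0 add0r => /bg ->; rewrite orbT.
Qed.

End MQSym.
Arguments xmon {m} w j.
Arguments MQSym m R : clear implicits.
Arguments monomial_mqsym {m} R w.

(* Main.v *)
(** Every monomial is [x_{j_1}^{w_1} ... x_{j_k}^{w_k}] for exactly one
    multi-composition [w] and one sequence [j_1 < ... < j_k]: the [j_l] are the
    second indices of the variables that occur in it, and the [w_l] their
    exponents. Hence the coefficient of [M_w] at such a monomial, with exponents
    [w'], is [1] if [w = w'] and [0] otherwise. Evaluation at one monomial for
    each [w] gives linear independence; a multi-quasisymmetric [f] is the sum of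
    the [c_w M_w], with [c_w] its coefficient at any monomial of type [w], and
    this sum is finite since there are only finitely many multi-compositions of
    a given degree. *)
Require Import Defs.
From mathcomp Require Import all_boot all_order all_algebra finmap.
From mathcomp Require Import boolp classical_sets functions cardinality fsbigop.
From mathcomp Require Import monalg.
Set Implicit Arguments.
Unset Strict Implicit.
Unset Printing Implicit Defensive.
Import GRing.Theory.
Local Open Scope classical_set_scope.
Local Open Scope ring_scope.

(** * Exponents of monomials; recovering [w] and [j] from a monomial *)

Section Monomials.
Variable m : nat.
Implicit Types (w : mcomp m) (u : monomial m).

Lemma expcmnS u n : expcmn u n.+1 = mmul u (expcmn u n).
Proof.
case: n => [|n]; first exact/esym/mulm1.
by rewrite /expcmn !iteropS.
Qed.

Lemma expcmnE u n (v : var m) : expcmn u n v = (n * u v)%N.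
Proof.
elim: n => [|n IH]; first by rewrite onecmE mul0n.
by rewrite expcmnS cmM IH mulSn.
Qed.

Lemma mdeg_expcmn u n : mdeg (expcmn u n) = (n * mdeg u)%N.
Proof.
elim: n => [|n IH]; first exact: mdeg1.
by rewrite expcmnS mdegM IH mulSn.
Qed.

Lemma prod_monomialE (I : Type) (r : seq I) (F : I -> monomial m) (v : var m) :
  (\big[mmul/mone]_(i <- r) F i) v = (\sum_(i <- r) F i v)%N.
Proof.
by apply: (big_morph (fun u : monomial m => u v)) => [x y|]; rewrite ?cmM ?cm1.
Qed.

Lemma xpowE (p : nat) (a : 'cV[nat]_m) i q :
  xpow p a (i, q) = ((p == q) * a i 0%R)%N.
Proof.
have factorE i' : expcmn (ucm ((i', p) : var m)) (a i' 0%R) (i, q) =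
    (a i' 0%R * ((i' == i) && (p == q)))%N.
  by rewrite (expcmnE (ucm ((i', p) : var m))) (ucmE ((i', p) : var m)).
rewrite prod_monomialE (bigD1 i)//= factorE eqxx.
rewrite big1; first by rewrite addn0 mulnC.
by move=> i' /negPf ii'; rewrite factorE ii'; apply: muln0.
Qed.

Lemma xmonE w (j : (mcomp_length w).-tuple nat) i p :
  xmon w j (i, p) = (\sum_l (tnth j l == p) * w i l)%N.
Proof.
by rewrite prod_monomialE; apply: eq_bigr => l _; rewrite xpowE mxE.
Qed.

Lemma xmon_tnth w (j : (mcomp_length w).-tuple nat) i l :
  uniq j -> xmon w j (i, tnth j l) = w i l.
Proof.
move=> /tuple_uniqP jI; rewrite xmonE (bigD1 l)//= eqxx mul1n.
rewrite big1 ?addn0// => l'.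
by rewrite (inj_eq jI) => /negPf ->.
Qed.

(** Column indices are compared by value because the two matrices have different types; this avoids
    transporting one along the equality of lengths. *)
Lemma mcomp_ext w w' : mcomp_length w = mcomp_length w' ->
  (forall i (l : 'I_(mcomp_length w)) (l' : 'I_(mcomp_length w')),
     l = l' :> nat -> w i l = w' i l') ->
  w = w'.
Proof.
case: w w' => [k A A0] [k' B B0] /= ek.
case: _ / ek B B0 => B B0 eAB.
have {}eAB : A = B by apply/matrixP => i l; apply: eAB.
by case: _ / eAB B0 => B0; congr MComp; apply: Prop_irrelevance.
Qed.

Lemma mcomp_col_gt0 w l : exists i, (0 < w i l)%N.
Proof.
apply: contrapT => /forallNP w0; have /eqP := mcomp_col_neq0 l; apply.
apply/colP => i; rewrite !mxE; apply/eqP; rewrite -leqn0 leqNgt.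
by apply/negP/w0.
Qed.

(** Exponents in different columns cannot cancel, and no column of [w] vanishes, so each entry of
    [j] leaves a trace in the monomial. *)
Lemma mem_xmon w (j : (mcomp_length w).-tuple nat) p :
  p \in j = [exists i, xmon w j (i, p) != 0%N].
Proof.
apply/tnthP/existsP => [[l ->]|[i]].
  have [i wil] := mcomp_col_gt0 l; exists i.
  by rewrite xmonE -lt0n (bigD1 l)//= eqxx mul1n addn_gt0 wil.
rewrite xmonE sum_nat_eq0 => /forallPn[l].
by rewrite muln_eq0 eqb0 negb_or negbK => /andP[/eqP <- _]; exists l.
Qed.

(** A strictly increasing sequence is determined by its set of entries, which [mem_xmon] reads off
    the monomial; then [w] is read off as exponents at these entries. *)
Lemma xmon_inj w w' (j : (mcomp_length w).-tuple nat)
    (j' : (mcomp_length w').-tuple nat) :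
  sorted ltn j -> sorted ltn j' -> xmon w j = xmon w' j' ->
  w = w' /\ (j = j' :> seq nat).
Proof.
move=> sj sj' e.
have ejj' : j = j' :> seq nat.
  apply: (irr_sorted_eq ltn_trans ltnn sj sj') => p.
  by rewrite [LHS]mem_xmon [RHS]mem_xmon e.
split=> //.
have uj := sorted_uniq ltn_trans ltnn sj.
have uj' := sorted_uniq ltn_trans ltnn sj'.
apply: mcomp_ext => [|i l l' ll'].
  by rewrite -(size_tuple j) ejj' size_tuple.
rewrite -(xmon_tnth i l uj) e -(xmon_tnth i l' uj').
by rewrite !(tnth_nth 0%N) ejj' ll'.
Qed.

Lemma xmon_surj u :
  exists w (j : (mcomp_length w).-tuple nat), sorted ltn j /\ xmon w j = u.
Proof.
pose J := sort leq (undup [seq v.2 | v <- finsupp u]).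
have memJ i p : u (i, p) != 0%N -> p \in J.
  rewrite cmE_neq0 mem_sort mem_undup => up.
  by apply/mapP; exists (i, p).
have sJ : sorted ltn J.
  rewrite ltn_sorted_uniq_leq sort_uniq undup_uniq.
  exact: (sort_sorted leq_total).
pose A := \matrix_(i < m, l < size J) u (i, tnth (in_tuple J) l).
have A0 l : col l A != 0.
  have /mapP[[i p] up /= e] :
      tnth (in_tuple J) l \in [seq v.2 | v <- finsupp u].
    by rewrite -mem_undup -(mem_sort leq) mem_tnth.
  apply/eqP => /matrixP /(_ i 0); rewrite !mxE e => /eqP.
  by apply/negP; rewrite cmE_neq0.
exists (MComp A0), (in_tuple J); split=> //.
apply/eqP/cmP => -[i p]; have [pJ|pJ] := boolP (p \in in_tuple J).
  have /tnthP[l ->] := pJ.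
  rewrite (xmon_tnth (w := MComp A0)) ?mxE//.
  exact: (sorted_uniq ltn_trans ltnn sJ).
(* Outside [J] both exponents vanish. *)
transitivity 0%N; last by apply/esym/eqP; apply: contraNT pJ => /memJ.
have := pJ; rewrite (mem_xmon (w := MComp A0)) negb_exists => /forallP /(_ i).
by rewrite negbK => /eqP.
Qed.

(** * Finiteness in bounded degree *)

Definition mcomp_degree w : nat := (\sum_l \sum_i w i l)%N.

Lemma mdeg_xmon w (j : (mcomp_length w).-tuple nat) :
  mdeg (xmon w j) = mcomp_degree w.
Proof.
rewrite mdeg_prod; apply: eq_bigr => l _; rewrite mdeg_prod.
apply: eq_bigr => i _; rewrite !mxE.
by rewrite mdeg_expcmn mdegU muln1.
Qed.

Lemma mcomp_length_le_degree w : (mcomp_length w <= mcomp_degree w)%N.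
Proof.
rewrite -[X in (X <= _)%N]card_ord -sum1_card; apply: leq_sum => l _.
have [i wil] := mcomp_col_gt0 l.
by rewrite (bigD1 i)//= ltn_addr.
Qed.

Lemma mcomp_entry_le_degree w i l : (w i l <= mcomp_degree w)%N.
Proof.
by rewrite /mcomp_degree (bigD1 l)//= (bigD1 i)//= -addnA leq_addr.
Qed.

(** The degree bounds both the length and every entry, so these multi-compositions are encoded by
    the finite type [T]. *)
Lemma finite_mcomp_degree_le d :
  finite_set [set w : mcomp m | (mcomp_degree w <= d)%N].
Proof.
pose T := {k : 'I_d.+1 & 'M['I_d.+1]_(m, k)}.
pose P (t : T) w := mcomp_length w = tag t /\
  forall i (l : 'I_(mcomp_length w)) (l' : 'I_(tag t)),
    l = l' :> nat -> w i l = tagged t i l'.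
have P_inj t w w' : P t w -> P t w' -> w = w'.
  move=> [k e] [k' e']; apply: mcomp_ext => [|i l l' ll'].
    by rewrite k k'.
  by rewrite (e _ _ (cast_ord k l))// -(e' _ l').
(* The empty multi-composition is the default value for codes with a zero column, which encode
   nothing. *)
pose w0 : mcomp m := @MComp m 0 0 (fun l => False_ind _ (notF (ltn_ord l))).
pose g (t : T) : mcomp m :=
  if pselect (exists w, P t w) is left e then projT1 (cid e) else w0.
apply: (@sub_finite_set _ _ [set g t | t in [set: T]]); last first.
  exact/finite_image/finite_finset.
move=> w /= wd.
have kd : (mcomp_length w < d.+1)%N.
  exact: leq_ltn_trans (mcomp_length_le_degree w) _.
pose A := map_mx (@inord d) w.
pose t : T := existT (fun k : 'I_d.+1 => 'M['I_d.+1]_(m, k)) (Ordinal kd) A.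
have Ptw : P t w.
  split=> // i l l' /ord_inj <-; rewrite mxE inordK//.
  exact: leq_ltn_trans (mcomp_entry_le_degree i l) _.
exists t => //; rewrite /g; case: pselect => [e|[]]; last by exists w.
by case: cid => w' /= /P_inj; apply.
Qed.

(** Selects one monomial of each type [w], at which series get evaluated. *)
Definition mcomp_iota w : (mcomp_length w).-tuple nat :=
  [tuple of iota 0 (mcomp_length w)].

Lemma sorted_mcomp_iota w : sorted ltn (mcomp_iota w).
Proof. exact: iota_ltn_sorted. Qed.

End Monomials.

(** * Linear independence and span of the [M_w] *)

Section MonomialMQSym.
Variables (m : nat) (R : nzRingType).
Implicit Types (w : mcomp m) (u : monomial m).

Lemma monomial_mqsym_xmon w w' (j : (mcomp_length w').-tuple nat) :
  sorted ltn j -> monomial_mqsym R w (xmon w' j) = `[< w = w' >]%:R.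
Proof.
move=> sj; case: asboolP => [ww'|ww'].
  case: _ / ww' j sj => j sj; rewrite /monomial_mqsym.
  (* By [xmon_inj], only the index [j] contributes. *)
  rewrite (fsbigE [:: j])//=.
  - by rewrite big_cons big_nil mem_set// eqxx addr0.
  - by move=> i; rewrite /= inE => /eqP ->.
  move=> i si; rewrite inE => ij; case: eqP => // e.
  by have [_ /val_inj eij] := xmon_inj si sj e; rewrite eij eqxx in ij.
apply: fsbig1 => i si; case: eqP => // e.
by have [] := xmon_inj si sj e.
Qed.

(** Coefficients in [linear_span] are indexed by vectors, so [w] must be recoverable from [M_w]. *)
Lemma monomial_mqsym_inj : injective (@monomial_mqsym m R).
Proof.
move=> w w' /(congr1 (fun f : fps m R => f (xmon w (mcomp_iota w)))).
rewrite !monomial_mqsym_xmon ?sorted_mcomp_iota//.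
rewrite asboolT//; case: asboolP => // _ /eqP.
by rewrite oner_eq0.
Qed.

Lemma monomial_mqsym_MQSym w : MQSym m R (monomial_mqsym R w).
Proof.
split; last first.
  by move=> w' j j' sj sj'; rewrite !monomial_mqsym_xmon.
exists (mcomp_degree w) => u; have [w' [j [sj <-]]] := xmon_surj u.
rewrite monomial_mqsym_xmon//; case: asboolP => [-> _|_]; last by rewrite eqxx.
by rewrite mdeg_xmon.
Qed.

Lemma fps_sumE (s : seq (fps m R)) (c : fps m R -> R) u :
  (\sum_(v <- s) c v *: v) u = \sum_(v <- s) c v * v u.
Proof. by apply: (big_morph (fun f : fps m R => f u)). Qed.

Lemma linear_span_MQSym (B : set (fps m R)) :
  B `<=` MQSym m R -> linear_span B `<=` MQSym m R.
Proof.
move=> BM f [s [c [sB ->]]]; elim: s sB => [_|v s IH sB].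
  rewrite big_nil; split=> [|w j j' _ _ //].
  by exists 0%N => u; rewrite eqxx.
rewrite big_cons; apply: MQSym_submod.
  by apply/BM/sB; rewrite /= mem_head.
by apply: IH => x /= xs; apply: sB; rewrite /= inE xs orbT.
Qed.

Lemma monomial_mqsym_linearly_independent :
  linearly_independent (range (@monomial_mqsym m R)).
Proof.
move=> s c us sB s0 v vs; have [w _ wv] := sB _ vs.
(* Evaluation at a monomial of type [w] kills every vector of [s] except [v]. *)
have /(congr1 (fun f : fps m R => f (xmon w (mcomp_iota w)))) := s0.
rewrite fps_sumE (bigD1_seq v)//=.
rewrite big1_seq ?addr0 => [|v' /andP[v'v /sB[w' _ e]]].
  by rewrite -{2}wv monomial_mqsym_xmon ?sorted_mcomp_iota// asboolT// mulr1.
rewrite -e monomial_mqsym_xmon ?sorted_mcomp_iota// asboolF ?mulr0// => ww'.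
by rewrite -e ww' wv eqxx in v'v.
Qed.

Lemma MQSym_linear_span :
  MQSym m R `<=` linear_span (range (@monomial_mqsym m R)).
Proof.
move=> f [[d fd] fsym].
pose S := [set monomial_mqsym R w |
  w in [set w : mcomp m | (mcomp_degree w <= d)%N]].
have finS : finite_set S by apply/finite_image/finite_mcomp_degree_le.
(* For [v = M_w], this is the coefficient of [f] at a monomial of type [w]; the value 0 off the
   range is a mere default. *)
pose c (v : fps m R) : R :=
  if pselect (exists w, monomial_mqsym R w = v) is left e
  then f (xmon (projT1 (cid e)) (mcomp_iota (projT1 (cid e)))) else 0.
have cE w : c (monomial_mqsym R w) = f (xmon w (mcomp_iota w)).
  rewrite /c; case: pselect => [e|[]]; last by exists w.
  by case: cid => w' /= /monomial_mqsym_inj ->.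
exists (fset_set S), c; split.
  by move=> v /=; rewrite in_fset_set// inE => -[w _ <-]; exists w.
apply/funext => u; have [w [j [sj <-]]] := xmon_surj u.
rewrite fps_sumE (fsym w j (mcomp_iota w)) ?sorted_mcomp_iota// -cE.
have term0 w' : w' <> w ->
    c (monomial_mqsym R w') * monomial_mqsym R w' (xmon w j) = 0.
  by move=> ww'; rewrite monomial_mqsym_xmon// asboolF// mulr0.
(* In degree at most [d] only the term of [M_w] survives; above [d] no term does, and [f] vanishes
   there by the choice of [d]. *)
have [wd|wd] := leqP (mcomp_degree w) d.
  rewrite (bigD1_seq (monomial_mqsym R w)) ?fset_uniq//=; last first.
    by rewrite in_fset_set// inE; exists w.
  rewrite big1_seq ?addr0 => [|v /andP[vw]].
    by rewrite monomial_mqsym_xmon// asboolT// mulr1.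
  rewrite in_fset_set// inE => -[w' _ e]; rewrite -e term0// => ww'.
  by rewrite -e ww' eqxx in vw.
rewrite big1_seq => [|v /andP[_]].
  rewrite cE; apply/eqP; apply: contraTT wd => /fd.
  by rewrite mdeg_xmon -leqNgt.
rewrite in_fset_set// inE => -[w' w'd <-]; apply: term0 => ww'.
by move: wd; rewrite -ww' ltnNge w'd.
Qed.

End MonomialMQSym.

(* A nonzero ring contains Q exactly when it receives a ring morphism from Q,
   such a morphism being automatically injective. *)
Theorem proposition2p6 (R : comNzRingType) (iota : {rmorphism rat -> R})
    (m : nat) (m_gt0 : (0 < m)%N) :
  is_basis_of (MQSym m R) [set monomial_mqsym R w | w in [set: mcomp m]].
Proof.
split; first exact: monomial_mqsym_linearly_independent.
apply/seteqP; split; last exact: MQSym_linear_span.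
by apply: linear_span_MQSym => _ [w _ <-]; apply: monomial_mqsym_MQSym.
Qed.
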